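(* Let $S=\{x_1,x_2,\ldots,x_8\}$ be a gcd-closed set of eight distinct positive integers with $|G_S(x_8)|=3$ and $|D_S(x_8)|=4$. Then $(S)\mid[S]$ if and only if $S$ satisfies the condition $\mathfrak{M}$.
   Context: $S$ is gcd-closed if $\gcd(x,y)\in S$ for all $x,y\in S$. The GCD matrix $(S)$ is the $8\times8$ matrix with $(i,j)$-entry $\gcd(x_i,x_j)$; the LCM matrix $[S]$ has $(i,j)$-entry $\mathrm{lcm}(x_i,x_j)$. For $A,B\in M_8(\mathbb{Z})$, $A\mid B$ means there is $C\in M_8(\mathbb{Z})$ with $B=AC$ or $B=CA$. For $x<y$ in $S$, $x$ is a greatest-type divisor of $y$ in $S$ if $x\mid y$ and $x\mid z\mid y$, $z\in S$ imply $z\in\{x,y\}$; $G_S(y)$ is the set of greatest-type divisors of $y$ in $S$. If $G_S(x)=\{y_1,\ldots,y_k\}$, then $D_S(x)=\{\gcd(y_{i_1},\ldots,y_{i_r}): 2\le r\le k,\ 1\le i_1<\cdots<i_r\le k\}$. An element $x\in S$ with $|G_S(x)|\ge2$ satisfies condition $\mathfrak{M}$ if $\mathrm{lcm}(y,y')=x$ for all distinct $y,y'\in G_S(x)$; the set $S$ satisfies condition $\mathfrak{M}$ if every $x\in S$ with $|G_S(x)|\ge2$ satisfies it. *)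

(* Defs.v *)
From mathcomp Require Import all_boot all_order all_algebra.
From mathcomp Require Import finmap.

Set Implicit Arguments.
Unset Strict Implicit.
Unset Printing Implicit Defensive.

Import GRing.Theory.
Local Open Scope nat_scope.
Local Open Scope fset_scope.

Definition gcd_closed (S : {fset nat}) : Prop :=
  forall x y : nat, x \in S -> y \in S -> gcdn x y \in S.

Definition gcd_matrix n (x : 'I_n -> nat) : 'M[int]_n :=
  \matrix_(i, j) (gcdn (x i) (x j))%:Z%R.

Definition lcm_matrix n (x : 'I_n -> nat) : 'M[int]_n :=
  \matrix_(i, j) (lcmn (x i) (x j))%:Z%R.

Definition mxdivides n (A B : 'M[int]_n) : Prop :=
  exists C : 'M[int]_n, (B = A *m C \/ B = C *m A)%R.

Definition greatest_type_divisor (S : {fset nat}) (x y : nat) : bool :=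
  [&& x < y, x %| y &
      [forall z : S, (x %| val z) && (val z %| y) ==> (val z \in [fset x; y])]].

Definition gtd_set (S : {fset nat}) (y : nat) : {fset nat} :=
  [fset x in S | greatest_type_divisor S x y].

Definition fset_gcd (Y : {fset nat}) : nat := \big[gcdn/0]_(y <- Y) y.

(* An increasing choice of r indices among those of y_1, ..., y_k is encoded
   as the subset Y of r elements that it selects. *)
Definition gtd_gcd_set (S : {fset nat}) (x : nat) : {fset nat} :=
  [fset fset_gcd Y | Y in fpowerset (gtd_set S x) & 2 <= #|` Y|].

Definition elt_condition_M (S : {fset nat}) (x : nat) : Prop :=
  forall y y' : nat, y \in gtd_set S x -> y' \in gtd_set S x -> y != y' ->
    lcmn y y' = x.

Definition condition_M (S : {fset nat}) : Prop :=
  forall x : nat, x \in S -> 2 <= #|` gtd_set S x| -> elt_condition_M S x.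

(* Main.v *)
(* Write m = x_8 and G_S(m) = {y_1, y_2, y_3}. Since |D_S(m)| = 4, the gcds of m
   with the subfamilies of the y_i are eight distinct elements, so they exhaust
   S: as a meet semilattice, S is a Boolean cube. Writing the atoms as da, db,
   dc, its elements are d, da, db, dc, dabu, dacv, dbcw and m = dabcuvwt, and S
   satisfies M exactly when u = v = w = t = 1.
   If this holds, lcm(p, q) = (p / d) gcd(p', q), where p' is the complement of
   p in the cube, so the quotient matrix is monomial and integral.
   Conversely, the gcd matrix maps the vector of Moebius signs mu(p, m) to
   alpha e_m, so alpha divides the sum of mu(p, m) lcm(q, p) over p, for every
   q. At the coatoms this sum is nonnegative and smaller than alpha, so it
   vanishes, which forces t = 1 and two of u, v, w to be 1; at an atom the same
   argument gives the third. *)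
Require Import Defs.
From mathcomp Require Import all_boot all_order all_algebra.
From mathcomp Require Import finmap zify ring.

Set Implicit Arguments.
Unset Strict Implicit.
Unset Printing Implicit Defensive.

Import Order.TTheory GRing.Theory Num.Theory.

(** * Monomial form of gcd-preserving maps on the Boolean cube *)

(* The triple of a point of the cube records which atoms lie below it. *)
Definition cube : Type := (bool * bool * bool)%type.
Definition cmeet (p q : cube) : cube :=
  (p.1.1 && q.1.1, p.1.2 && q.1.2, p.2 && q.2).
Definition cjoin (p q : cube) : cube :=
  (p.1.1 || q.1.1, p.1.2 || q.1.2, p.2 || q.2).
Definition ccompl (p : cube) : cube := (~~ p.1.1, ~~ p.1.2, ~~ p.2).
Definition ctop : cube := (true, true, true).

(** Boolean exponents count as 0 or 1. For a meet morphism with positive values, [u], [v], [w] are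
    the quotients of the coatoms by the lcm of their two atoms, and [t] that of the top by the lcm
    of the coatoms. *)
Definition cube_monomial (d a b c u v w t : nat) (p : cube) : nat :=
  let: (i, j, k) := p in
  d * a ^ i * b ^ j * c ^ k * u ^ (i && j) * v ^ (i && k) * w ^ (j && k)
    * t ^ [&& i, j & k].

Definition meet_morphism (s : cube -> nat) : Prop :=
  forall p q, gcdn (s p) (s q) = s (cmeet p q).

Lemma gcdn_lcml m n p : gcdn (lcmn m n) p = lcmn (gcdn m p) (gcdn n p).
Proof. exact: (@Order.meetUl _ natdvd m n p). Qed.

(** Each parameter is the quotient of a value by the lcm of the values below it. These lcms follow
    from lcm times gcd being the product, the gcds being values of [s]. *)
Lemma meet_morphism_monomial (s : cube -> nat) :
  (forall p, 0 < s p) -> meet_morphism s ->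
  exists d a b c u v w t, s =1 cube_monomial d a b c u v w t.
Proof.
move=> s_gt0 sM.
have le_dvd p q : cmeet p q = p -> s p %| s q.
  by move=> <-; rewrite -sM dvdn_gcdr.
have lcm_eq p q l : s p * s q = l * s (cmeet p q) -> lcmn (s p) (s q) = l.
  move=> e; apply/eqP; rewrite -(eqn_pmul2r (s_gt0 (cmeet p q))) -e.
  by rewrite -sM muln_lcm_gcd.
set d := s (false, false, false).
have d_gt0 : 0 < d by exact: s_gt0.
have /dvdnP[a ea] : d %| s (true, false, false) by exact: le_dvd.
have /dvdnP[b eb] : d %| s (false, true, false) by exact: le_dvd.
have /dvdnP[c ec] : d %| s (false, false, true) by exact: le_dvd.
have lab : lcmn (s (true, false, false)) (s (false, true, false)) = d * a * b.
  by apply: lcm_eq; rewrite ea eb /cmeet /= -/d; ring.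
have lac : lcmn (s (true, false, false)) (s (false, false, true)) = d * a * c.
  by apply: lcm_eq; rewrite ea ec /cmeet /= -/d; ring.
have lbc : lcmn (s (false, true, false)) (s (false, false, true)) = d * b * c.
  by apply: lcm_eq; rewrite eb ec /cmeet /= -/d; ring.
have /dvdnP[u eu] : d * a * b %| s (true, true, false).
  by rewrite -lab dvdn_lcm !le_dvd.
have /dvdnP[v ev] : d * a * c %| s (true, false, true).
  by rewrite -lac dvdn_lcm !le_dvd.
have /dvdnP[w ew] : d * b * c %| s (false, true, true).
  by rewrite -lbc dvdn_lcm !le_dvd.
have luv : lcmn (s (true, true, false)) (s (true, false, true))
    = d * a * b * c * u * v.
  by apply: lcm_eq; rewrite eu ev /cmeet /= ea; ring.
have bc_gt0 : 0 < d * b * c.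
  have := s_gt0 (false, true, true).
  by rewrite ew muln_gt0 => /andP[].
have luvw : lcmn (d * a * b * c * u * v) (s (false, true, true))
    = d * a * b * c * u * v * w.
  (* By distributivity, the gcd of the third coatom with the lcm of the other two is the lcm of its
     own two atoms, [d * b * c]. *)
  apply/eqP; rewrite -(eqn_pmul2r bc_gt0) -{1}lbc.
  have -> : lcmn (s (false, true, false)) (s (false, false, true)) =
      gcdn (d * a * b * c * u * v) (s (false, true, true)).
    by rewrite -luv gcdn_lcml !sM.
  by rewrite muln_lcm_gcd ew; apply/eqP; ring.
have /dvdnP[t et] : d * a * b * c * u * v * w %| s ctop.
  by rewrite -luvw dvdn_lcm -luv dvdn_lcm !le_dvd.
exists d, a, b, c, u, v, w, t => -[[[] []] []] /=; rewrite /cube_monomial /=;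
  rewrite ?(et, eu, ev, ew, ea, eb, ec, muln1, expn1, expn0) //; try by ring.
Qed.

(** The product is divided by the gcd factor by factor, since x + y = (x || y) + (x && y) for
    Boolean exponents. *)
Lemma lcmn_cube_monomial d a b c u v w t
    (s := cube_monomial d a b c u v w t) (p q : cube) :
  (forall p, 0 < s p) -> meet_morphism s ->
  lcmn (s p) (s q) =
    d * a ^ (p.1.1 || q.1.1) * b ^ (p.1.2 || q.1.2) * c ^ (p.2 || q.2)
    * u ^ (p.1.1 && p.1.2 || q.1.1 && q.1.2)
    * v ^ (p.1.1 && p.2 || q.1.1 && q.2)
    * w ^ (p.1.2 && p.2 || q.1.2 && q.2)
    * t ^ ([&& p.1.1, p.1.2 & p.2] || [&& q.1.1, q.1.2 & q.2]).
Proof.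
move=> s_gt0 sM; apply/eqP; rewrite -(eqn_pmul2r (s_gt0 (cmeet p q))) -{1}sM.
rewrite muln_lcm_gcd /s /cmeet.
move: p q => [[i j] k] [[i' j'] k'] /=.
have expUI m n e (x y : bool) :
    m * e ^ x * (n * e ^ y) = m * n * (e ^ (x || y) * e ^ (x && y)).
  by rewrite mulnACA; case: x y => [] []; rewrite ?(muln1, mul1n).
have -> : [&& i && i', j && j' & k && k'] = [&& i, j & k] && [&& i', j' & k'].
  by case: i i' j j' => [] [] [] [] //=; rewrite ?andbF.
have [-> -> ->] : [/\ (i && i') && (j && j') = (i && j) && (i' && j'),
  (i && i') && (k && k') = (i && k) && (i' && k') &
  (j && j') && (k && k') = (j && k) && (j' && k')].
  by split; rewrite andbACA.
rewrite 7!expUI; apply/eqP; ring.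
Qed.

(** * Integer inequalities behind the divisibility argument *)

Section Arithmetic.
Local Open Scope ring_scope.

Lemma dvdz_small_eq0 (m n : int) : (m %| n)%Z -> 0 <= n -> n < m -> n = 0.
Proof.
move=> /dvdzP[k ->] n_ge0 lt_nm; have m_gt0 := le_lt_trans n_ge0 lt_nm.
move: n_ge0 lt_nm; rewrite pmulr_lge0 // gtr_pMl // => k_ge0 k_lt1.
by have -> : k = 0 by [lia]; rewrite mul0r.
Qed.

(** The dividend is nonnegative and smaller than the divisor, so it is zero; its last factor is (v -
    1)(w - 1) + vw(t - 1), a sum of nonnegative terms. *)
Lemma coatom_row_arith (d a b c u v w t : int) :
    0 < d -> 1 < a -> 1 < b -> 1 < c -> 0 < u -> 0 < v -> 0 < w -> 0 < t ->
    (d * (a * b * c * u * v * w * t - a * b * u - a * c * v - b * c * w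
          + a + b + c - 1)
      %| d * (a * b * c * u * (v * w * t - v - w + 1)))%Z ->
  t = 1 /\ (v = 1 \/ w = 1).
Proof.
move=> d0 a1 b1 c1 u0 v0 w0 t0; rewrite dvdz_mul2l ?gt_eqF // => dv.
have [a' [ea a'0]] : exists a', a = a' + 2 /\ 0 <= a' by exists (a - 2); lia.
have [b' [eb b'0]] : exists a', b = a' + 2 /\ 0 <= a' by exists (b - 2); lia.
have [c' [ec c'0]] : exists a', c = a' + 2 /\ 0 <= a' by exists (c - 2); lia.
have [u' [eu u'0]] : exists a', u = a' + 1 /\ 0 <= a' by exists (u - 1); lia.
have [v' [ev v'0]] : exists a', v = a' + 1 /\ 0 <= a' by exists (v - 1); lia.
have [w' [ew w'0]] : exists a', w = a' + 1 /\ 0 <= a' by exists (w - 1); lia.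
have [t' [et t'0]] : exists a', t = a' + 1 /\ 0 <= a' by exists (t - 1); lia.
have factE : v * w * t - v - w + 1 = v' * w' + v * w * t'.
  by rewrite ev ew et; ring.
have abcu0 : 0 < a * b * c * u by rewrite !mulr_gt0 //; lia.
have vw0 : 0 < v * w by rewrite mulr_gt0.
have N0 : a * b * c * u * (v * w * t - v - w + 1) = 0.
  apply: (dvdz_small_eq0 dv).
    rewrite factE; apply: mulr_ge0; first exact: ltW.
    by apply: addr_ge0; apply: mulr_ge0 => //; exact: ltW.
  (* The shifts by 2 and 1 leave only nonnegative coefficients. *)
  rewrite -subr_gt0.
  have -> : a * b * c * u * v * w * t - a * b * u - a * c * v - b * c * w
          + a + b + c - 1 - a * b * c * u * (v * w * t - v - w + 1) =
      (a' + 1) * (b' + 1) * (c' + 1) + u' * a * b * (c' + 1 + c * v' + c * w')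
      + v' * a * c * (b' + 1) + w' * b * c * (a' + 1).
    by rewrite ea eb ec eu ev ew; ring.
  do 3 (apply: ltr_wpDr;
    first by repeat first [apply: mulr_ge0 | apply: addr_ge0]; lia).
  by rewrite !mulr_gt0 //; lia.
move/eqP: N0; rewrite mulf_eq0 gt_eqF //= factE => /eqP N0.
have [v'w' vwt'] : v' * w' = 0 /\ v * w * t' = 0.
  have := mulr_ge0 v'0 w'0; have := mulr_ge0 (ltW vw0) t'0; lia.
split.
  move/eqP: vwt'; rewrite mulf_eq0 gt_eqF //= => /eqP t'E; lia.
move/eqP: v'w'; rewrite mulf_eq0 => /orP[]/eqP e; [left | right]; lia.
Qed.

(** Once a - 1 is cancelled, divisor minus dividend is (b - 1)(c - 1) > 0, so the dividend
    vanishes. *)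
Lemma atom_row_arith (d a b c w : int) :
    0 < d -> 1 < a -> 1 < b -> 1 < c -> 0 < w ->
    (d * (a * b * c * w - a * b - a * c - b * c * w + a + b + c - 1)
      %| d * (b * c * (a - 1) * (w - 1)))%Z ->
  w = 1.
Proof.
move=> d0 a1 b1 c1 w0; rewrite dvdz_mul2l ?gt_eqF //.
have -> : a * b * c * w - a * b - a * c - b * c * w + a + b + c - 1 =
  (a - 1) * (b * c * w - b - c + 1) by ring.
have -> : b * c * (a - 1) * (w - 1) = (a - 1) * (b * c * (w - 1)) by ring.
rewrite dvdz_mul2l ?subr_eq0 ?gt_eqF // => dv.
have bc0 : 0 < b * c by apply: mulr_gt0; lia.
have /eqP : b * c * (w - 1) = 0.
  apply: (dvdz_small_eq0 dv); first by apply: mulr_ge0; lia.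
  rewrite -subr_gt0.
  have -> : b * c * w - b - c + 1 - b * c * (w - 1) = (b - 1) * (c - 1) by ring.
  by apply: mulr_gt0; lia.
by rewrite mulf_eq0 gt_eqF //= subr_eq0 => /eqP.
Qed.

End Arithmetic.

(** * Moebius sums and divisibility over the cube *)

Section Cube.
Local Open Scope ring_scope.

(** The sum of [f] weighted by the Moebius function mu(p, [ctop]) of the cube. *)
Definition altsum (f : cube -> int) : int :=
  f (true, true, true) - f (true, true, false) - f (true, false, true)
  - f (false, true, true) + f (true, false, false) + f (false, true, false)
  + f (false, false, true) - f (false, false, false).

Lemma altsum_sum (g c : cube -> int) (h : cube -> cube -> int) :
  (forall p, g p = \sum_r c r * h r p) ->
  altsum g = \sum_r c r * altsum (h r).
Proof.
move=> gE; rewrite /altsum !gE -!(sumrB, big_split) /=.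
by apply: eq_bigr => r _; ring.
Qed.

(* Toggling a coordinate outside [r] preserves the meet with [r] and changes the
   sign. *)
Lemma altsum_gcd (s : cube -> nat) (r : cube) : meet_morphism s -> r != ctop ->
  altsum (fun p => (gcdn (s r) (s p))%:Z) = 0.
Proof.
move=> sM; rewrite /altsum !sM /cmeet; case: r => [[[] []] []] //= _; ring.
Qed.

Lemma altsum_top (s : cube -> nat) : meet_morphism s ->
  altsum (fun p => (gcdn (s ctop) (s p))%:Z) = altsum (fun p => (s p)%:Z).
Proof. by move=> sM; rewrite /altsum !sM. Qed.

(** The identity [S] = C (S), with rows and columns indexed by the cube. *)
Definition cube_divides (s : cube -> nat) : Prop :=
  exists C : cube -> cube -> int, forall q p,
    (lcmn (s q) (s p))%:Z = \sum_r C q r * (gcdn (s r) (s p))%:Z.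

Lemma eq_cube_divides (s s' : cube -> nat) :
  s =1 s' -> cube_divides s -> cube_divides s'.
Proof.
move=> eq_s [C CE]; exists C => q p; rewrite -!eq_s CE.
by apply: eq_bigr => r _; rewrite -eq_s.
Qed.

(** Under the alternating sum over [p], only the term [r = ctop] of row [q] survives. *)
Lemma altsum_dvd_lcm (s : cube -> nat) (q : cube) :
    meet_morphism s -> cube_divides s ->
  (altsum (fun p => (s p)%:Z) %| altsum (fun p => (lcmn (s q) (s p))%:Z))%Z.
Proof.
move=> sM [C CE]; rewrite (altsum_sum (CE q)) (bigD1 ctop) //= altsum_top //.
rewrite big1 ?addr0 ?dvdz_mull // => r /(altsum_gcd sM) ->.
by rewrite mulr0.
Qed.

(** * Divisibility and lcms in terms of the parameters *)

Section Monomial.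
Variables d a b c u v w t : nat.
Let s := cube_monomial d a b c u v w t.
Hypothesis s_gt0 : forall p, (0 < s p)%N.
Hypothesis s_inj : injective s.
Hypothesis sM : meet_morphism s.

Lemma monomial_params_gt0 : [/\ (0 < d)%N, (1 < a)%N, (1 < b)%N & (1 < c)%N] /\
  [/\ (0 < u)%N, (0 < v)%N, (0 < w)%N & (0 < t)%N].
Proof.
have := s_gt0 ctop; rewrite /s /= !expn1 !muln_gt0 -!andbA.
move=> /andP[d0 /and4P[a0 b0 c0 /and4P[u0 v0 w0 t0]]]; split; split=> //.
- rewrite ltn_neqAle a0 andbT; apply/eqP => a1.
  have /s_inj // : s (true, false, false) = s (false, false, false).
  by rewrite /s -a1 /= !(expn0, muln1).
- rewrite ltn_neqAle b0 andbT; apply/eqP => a1.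
  have /s_inj // : s (false, true, false) = s (false, false, false).
  by rewrite /s -a1 /= !(expn0, muln1).
- rewrite ltn_neqAle c0 andbT; apply/eqP => a1.
  have /s_inj // : s (false, false, true) = s (false, false, false).
  by rewrite /s -a1 /= !(expn0, muln1).
Qed.

Lemma cube_divides_monomial :
  cube_divides s -> [/\ u = 1, v = 1, w = 1 & t = 1]%N.
Proof.
move=> sdiv.
have [[d0 a1 b1 c1] [u0 v0 w0 t0]] := monomial_params_gt0.
have dv q := altsum_dvd_lcm q sM sdiv.
have topE : altsum (fun p => (s p)%:Z) = (d%:Z * (a%:Z * b * c * u * v * w * t
    - a%:Z * b * u - a%:Z * c * v - b%:Z * c * w + a%:Z + b%:Z + c%:Z - 1)).
  rewrite /altsum /s /= !(expn0, expn1, muln1) !PoszM; ring.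
have lcmE p q := lcmn_cube_monomial p q s_gt0 sM.
have rowE q m n : altsum (fun p => (s p)%:Z) = m ->
    altsum (fun p => (lcmn (s q) (s p))%:Z) = n -> (m %| n)%Z.
  by move=> <- <-; exact: dv.
have [u0' v0' w0' t0'] : [/\ 0 < u%:Z, 0 < v%:Z, 0 < w%:Z & 0 < t%:Z].
  by split; lia.
have [d0' a1' b1' c1'] : [/\ 0 < d%:Z, 1 < a%:Z, 1 < b%:Z & 1 < c%:Z].
  by split; lia.
(* The three coatom rows agree up to a permutation of the atoms. Together they leave at most one of
   [u], [v], [w] different from 1. *)
have [t1 vw1] : t%:Z = 1 /\ (v%:Z = 1 \/ w%:Z = 1).
  apply: (@coatom_row_arith d a b c u) => //.
  apply: (rowE (true, true, false)); first by rewrite topE; ring.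
  rewrite /altsum !lcmE /= !(expn0, expn1, muln1) !PoszM; ring.
have [_ uw1] : t%:Z = 1 /\ (u%:Z = 1 \/ w%:Z = 1).
  apply: (@coatom_row_arith d a c b v) => //.
  apply: (rowE (true, false, true)); first by rewrite topE; ring.
  rewrite /altsum !lcmE /= !(expn0, expn1, muln1) !PoszM; ring.
have [_ uv1] : t%:Z = 1 /\ (u%:Z = 1 \/ v%:Z = 1).
  apply: (@coatom_row_arith d b c a w) => //.
  apply: (rowE (false, true, true)); first by rewrite topE; ring.
  rewrite /altsum !lcmE /= !(expn0, expn1, muln1) !PoszM; ring.
(* The remaining factor is detected by the row of an atom below its coatom. *)
have w1 : u%:Z = 1 -> v%:Z = 1 -> w%:Z = 1.
  move=> u1 v1; apply: (@atom_row_arith d a b c) => //.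
  apply: (rowE (false, true, false)); first by rewrite topE ?u1 ?v1 ?t1; ring.
  rewrite /altsum !lcmE /= !(expn0, expn1, muln1) !PoszM ?u1 ?v1 ?t1; ring.
have v1 : u%:Z = 1 -> w%:Z = 1 -> v%:Z = 1.
  move=> u1 w1'; apply: (@atom_row_arith d b a c) => //.
  apply: (rowE (true, false, false)); first by rewrite topE ?u1 ?w1' ?t1; ring.
  rewrite /altsum !lcmE /= !(expn0, expn1, muln1) !PoszM ?u1 ?w1' ?t1; ring.
have u1 : v%:Z = 1 -> w%:Z = 1 -> u%:Z = 1.
  move=> v1' w1'; apply: (@atom_row_arith d c a b) => //.
  apply: (rowE (true, false, false)); first by rewrite topE ?v1' ?w1' ?t1; ring.
  rewrite /altsum !lcmE /= !(expn0, expn1, muln1) !PoszM ?v1' ?w1' ?t1; ring.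
by split; lia.
Qed.

Lemma monomial_cube_divides :
  [/\ u = 1, v = 1, w = 1 & t = 1]%N -> cube_divides s.
Proof.
have [[d0 a1 b1 c1] _] := monomial_params_gt0.
move=> uvwt1; exists (fun q r => if r == ccompl q then (s q %/ d)%:Z else 0).
move=> q p; rewrite (bigD1 (ccompl q)) // eqxx big1; last first.
  by move=> r /negPf ->; rewrite mul0r.
rewrite [RHS]addr0 -PoszM sM; congr Posz; apply/eqP.
have divE : (s q = s q %/ d * d)%N.
  rewrite divnK //; case: q => [[i j] k].
  by rewrite /s /= -!mulnA dvdn_mulr.
rewrite -(eqn_pmul2r d0) mulnAC -divE lcmn_cube_monomial // /s.
case: uvwt1 => -> -> -> ->; case: p q {divE} => [[i j] k] [[i' j'] k'] /=.
rewrite /cmeet /= !exp1n !muln1; apply/eqP.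
(* The gcd with the complement of [q] supplies exactly the atoms of [p] missing from [q]. *)
have orE e (x y : bool) : (e ^ (x || y) = e ^ x * e ^ (~~ x && y))%N.
  by case: x y => [] []; rewrite ?(muln1, mul1n).
rewrite !orE; ring.
Qed.

Lemma lcm_closed_monomial :
  [/\ u = 1, v = 1, w = 1 & t = 1]%N ->
  forall p q, lcmn (s p) (s q) = s (cjoin p q).
Proof.
move=> uvwt1 p q; rewrite lcmn_cube_monomial // /s.
by case: uvwt1 => -> -> -> ->; rewrite /cjoin /= !exp1n.
Qed.

(** The first three equations isolate [u], [v], [w]; with these equal to 1, the fourth isolates
    [t]. *)
Lemma monomial_lcm_closed
    (a1 := (true, false, false)) (a2 := (false, true, false))
    (a3 := (false, false, true)) :
    lcmn (s a1) (s a2) = s (true, true, false) ->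
    lcmn (s a1) (s a3) = s (true, false, true) ->
    lcmn (s a2) (s a3) = s (false, true, true) ->
    lcmn (s (true, true, false)) (s (true, false, true)) = s ctop ->
  [/\ u = 1, v = 1, w = 1 & t = 1]%N.
Proof.
have [[d0 /ltnW a0 /ltnW b0 /ltnW c0] _] := monomial_params_gt0.
rewrite !lcmn_cube_monomial // /s /= !(expn0, expn1, muln1).
have eq1 m n : (0 < m -> m = m * n -> n = 1)%N.
  by move=> m0 /esym/eqP; rewrite -{2}[m]muln1 eqn_pmul2l // => /eqP.
move=> /eq1 -> //; last by rewrite !muln_gt0 d0 a0.
move=> /eq1 -> //; last by rewrite !muln_gt0 d0 a0.
move=> /eq1 -> //; last by rewrite !muln_gt0 d0 b0.
by rewrite !muln1 => /eq1 -> //; rewrite !muln_gt0 d0 a0 b0.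
Qed.

End Monomial.

End Cube.

(** * Divisibility criteria for gcds and greatest-type divisors *)

Section Divisibility.
Local Open Scope nat_scope.

Lemma eqn_dvdn_ext m n : (forall e, (e %| m) = (e %| n)) -> m = n.
Proof. by move=> e; apply/eqP; rewrite eqn_dvd e dvdnn -e dvdnn. Qed.

Lemma dvdn_biggcd (e : nat) (r : seq nat) :
  (e %| \big[gcdn/0]_(y <- r) y) = all (dvdn e) r.
Proof.
elim: r => [|y r IHr]; first by rewrite big_nil dvdn0.
by rewrite big_cons dvdn_gcd IHr.
Qed.

Lemma gtd_setP (S : {fset nat}) (y m : nat) :
  reflect [/\ y \in S, y < m, y %| m &
             forall z, z \in S -> y %| z -> z %| m -> z = y \/ z = m]
          (y \in gtd_set S m).
Proof.
rewrite !inE /= /greatest_type_divisor; apply: (iffP andP).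
  move=> [yS /and3P[lt_ym dv_ym /forallP H]]; split=> // z zS dyz dzm.
  have /implyP := H [` zS]%fset; rewrite /= dyz dzm => /(_ isT).
  by rewrite !inE => /orP[]/eqP; [left | right].
move=> [yS lt_ym dv_ym H]; split=> //; apply/and3P; split=> //.
apply/forallP => z; apply/implyP => /andP[dyz dzm]; rewrite !inE.
by have [||| -> | ->] := H (val z); rewrite ?eqxx ?orbT // (valP z).
Qed.

End Divisibility.

(** * The cube inside a gcd-closed set *)

Section GcdClosed.
Local Open Scope nat_scope.

Lemma gtd_gcd_cube (S : {fset nat}) (m : nat) :
    gcd_closed S -> m \in S -> #|` gtd_set S m| = 3 ->
    #|` gtd_gcd_set S m| = 4 ->
  exists s : cube -> nat,
    [/\ forall p, s p \in S, injective s & meet_morphism s].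
Proof.
move=> Sgcd mS cardG cardD.
have [y1 [y2 [y3 G_E]]] : exists y1 y2 y3, gtd_set S m =i [:: y1; y2; y3].
  case eG: (enum_fset (gtd_set S m)) cardG => [|y1 [|y2 [|y3 []]]] //= _.
  by exists y1, y2, y3 => y; rewrite -eG.
have Gdvd y : y \in gtd_set S m -> y \in S /\ y %| m by case/gtd_setP.
have [y1S y1m] : y1 \in S /\ y1 %| m by apply: Gdvd; rewrite G_E !inE eqxx.
have [y2S y2m] : y2 \in S /\ y2 %| m.
  by apply: Gdvd; rewrite G_E !inE eqxx orbT.
have [y3S y3m] : y3 \in S /\ y3 %| m.
  by apply: Gdvd; rewrite G_E !inE eqxx !orbT.
(* A true coordinate drops [y_i], 0 being neutral for gcd. Including [m] makes the top value [m]
   instead of 0. *)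
pose s (p : cube) := gcdn (gcdn (gcdn m (if p.1.1 then 0 else y1))
  (if p.1.2 then 0 else y2)) (if p.2 then 0 else y3).
have dvd_s e p : (e %| s p) =
    [&& e %| m, p.1.1 || (e %| y1), p.1.2 || (e %| y2) & p.2 || (e %| y3)].
  by rewrite /s !dvdn_gcd -!andbA; case: p => [[[] []] []] /=; rewrite ?dvdn0.
have sM : meet_morphism s.
  move=> p q; apply: eqn_dvdn_ext => e; rewrite dvdn_gcd !dvd_s /cmeet.
  move: p q => [[i j] k] [[i' j'] k'] /=.
  case: (e %| m) => //=.
  by case: (e %| y1); case: (e %| y2); case: (e %| y3);
     case: i i' j j' k k' => [] [] [] [] [] [].
exists s; split=> //.
  have sub z y (b : bool) : z \in S -> y \in S ->
      gcdn z (if b then 0 else y) \in S.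
    by case: b => zS yS; [rewrite gcdn0 | exact: Sgcd].
  by move=> p; rewrite /s !sub.
(* At most one dropped index: the subfamilies of at least two [y_i]. *)
pose low := [:: (false, false, false); (true, false, false);
                (false, true, false); (false, false, true)].
have Dlow : {subset gtd_gcd_set S m <= map s low}.
  move=> z /imfsetP[/= Y]; rewrite inE fpowersetE => /andP[/fsubsetP YG Y2] ->.
  pose p := (y1 \notin Y, y2 \notin Y, y3 \notin Y).
  have YE y : y \in Y -> y \in [:: y1; y2; y3] by move=> /YG; rewrite G_E.
  have -> : fset_gcd Y = s p.
    apply: eqn_dvdn_ext => e; rewrite dvdn_biggcd dvd_s /=.
    apply/allP/and4P => [eY | [em e1 e2 e3] y yY].
      split; try by case: (boolP (_ \in Y)) => //= /eY.
      (* [Y] is nonempty, so a common divisor of [Y] divides [m] through one of its elements. *)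
      case eYn: (enum_fset Y) Y2 => [|y r] // _.
      have yY : y \in Y by rewrite -[y \in Y]/(y \in enum_fset Y) eYn mem_head.
      by apply: dvdn_trans (eY y yY) _; case: (Gdvd y (YG y yY)).
    have := YE y yY; rewrite !inE => /or3P[]/eqP ey; move: yY; rewrite ey => yY.
    - by rewrite yY in e1.
    - by rewrite yY in e2.
    - by rewrite yY in e3.
  suff pl : p \in low by exact: (map_f s pl).
  have small a : {subset Y <= [:: a]} -> False.
    by move=> sub; have := uniq_leq_size (fset_uniq Y) sub; rewrite leqNgt Y2.
  rewrite /low /p !inE.
  case: (boolP (y1 \in Y)) => h1; case: (boolP (y2 \in Y)) => h2;
  case: (boolP (y3 \in Y)) => h3 //=; exfalso;
  [apply: (small y1) | apply: (small y2) | apply: (small y3)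
    | apply: (small y3)]; move=> y yY; have := YE y yY; rewrite !inE;
  by case/or3P=> /eqP ey; move: h1 h2 h3; rewrite -?ey yY ?eqxx.
(* Four distinct gcds lie among these four values, so the values are distinct. *)
have : uniq (map s low).
  by apply: leq_size_uniq (fset_uniq _) Dlow _; rewrite cardD.
rewrite /= !inE !negb_or -!andbA => /and4P[n1 n2 n3 _].
move=> [[i j] k] [[i' j'] k'] spq.
(* Meeting with an atom yields the atom or the bottom, whose values differ; this recovers each
   coordinate. *)
have meetE e := congr1 (gcdn (s e)) spq.
have := meetE (true, false, false); have := meetE (false, true, false).
have := meetE (false, false, true); rewrite !sM /cmeet /=.
move: n1 n2 n3 => /eqP n1 /eqP n2 /eqP n3.
by case: i i' j j' k k' {spq meetE} => [] [] [] [] [] [] //=; congruence.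
Qed.

(** * Condition M when the cube exhausts the set *)

Section CubeImage.
Variables (S : {fset nat}) (s : cube -> nat).
Hypothesis S_E : forall z, z \in S -> exists p, z = s p.
Hypothesis sS : forall p, s p \in S.
Hypothesis s_gt0 : forall p, 0 < s p.
Hypothesis s_inj : injective s.
Hypothesis sM : meet_morphism s.

Lemma cube_dvdE p q : (s p %| s q) = (cmeet p q == p).
Proof.
apply/idP/eqP => [/gcdn_idPl e | <-]; last by rewrite -sM dvdn_gcdr.
by apply: s_inj; rewrite -sM.
Qed.

(** If the lcm is not [m], maximality of [y] and of [y'] makes it equal to both, although they are
    distinct. *)
Lemma lcm_closed_condition_M :
  (forall p q, lcmn (s p) (s q) \in S) -> condition_M S.
Proof.
move=> lcmS m mS _ y y' /gtd_setP[yS _ dym maxy] /gtd_setP[y'S _ dy'm maxy'] ny.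
have lS : lcmn y y' \in S.
  by have [p ->] := S_E yS; have [q ->] := S_E y'S.
have dlm : lcmn y y' %| m by rewrite dvdn_lcm dym.
have [l|//] := maxy _ lS (dvdn_lcml y y') dlm.
have [l'|//] := maxy' _ lS (dvdn_lcmr y y') dlm.
by rewrite -l l' eqxx in ny.
Qed.

(** Covering pairs of the cube suffice because every element of [S] is a value of [s]. *)
Lemma cube_gtd p q : cmeet p q = p -> p != q ->
  (forall r, cmeet p r = p -> cmeet r q = r -> r = p \/ r = q) ->
  s p \in gtd_set S (s q).
Proof.
move=> pq npq cov; have dv : s p %| s q by rewrite cube_dvdE pq.
apply/gtd_setP; split=> //.
  rewrite ltn_neqAle dvdn_leq // andbT; apply: contraNneq npq => /s_inj -> //.
move=> z /S_E[r ->]; rewrite !cube_dvdE => /eqP pr /eqP rq.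
by have [->|->] := cov r pr rq; [left | right].
Qed.

Lemma condition_M_lcm p p' q : condition_M S -> p != p' ->
  s p \in gtd_set S (s q) -> s p' \in gtd_set S (s q) ->
  lcmn (s p) (s p') = s q.
Proof.
move=> SM npp' gp gp'.
have ns : s p != s p' by apply: contraNneq npp' => /s_inj ->.
apply: (SM (s q)) => //.
have U : uniq [:: s p; s p'] by rewrite /= inE ns.
by apply: (uniq_leq_size U) => z; rewrite in_cons mem_seq1 => /orP[]/eqP->.
Qed.

(** Both sides are equivalent to [u = v = w = t = 1]. *)
Lemma condition_M_cube_divides : condition_M S <-> cube_divides s.
Proof.
have [d [a [b [c [u [v [w [t sE]]]]]]]] := meet_morphism_monomial s_gt0 sM.
pose s' := cube_monomial d a b c u v w t.
have s'E p : s' p = s p by rewrite sE.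
have s'_gt0 p : 0 < s' p by rewrite s'E.
have s'_inj : injective s' by move=> p q; rewrite !s'E => /s_inj.
have s'M : meet_morphism s' by move=> p q; rewrite !s'E sM.
split=> [SM | sC].
  apply: (eq_cube_divides s'E).
  apply: (monomial_cube_divides s'_gt0 s'_inj s'M).
  apply: (monomial_lcm_closed s'_gt0 s'_inj s'M); rewrite -!sE;
    apply: condition_M_lcm => //; apply: cube_gtd => //;
    by move=> [[[] []] []] //; (by left) || (by right).
have uvwt := cube_divides_monomial s'_gt0 s'_inj s'M (eq_cube_divides sE sC).
apply: lcm_closed_condition_M => p q.
have lcmE : lcmn (s' p) (s' q) = s' (cjoin p q) by exact: lcm_closed_monomial.
by move: lcmE; rewrite !s'E => ->.
Qed.

End CubeImage.
End GcdClosed.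

(** * Transfer from the cube to matrices *)

Lemma mxdivides_symmetric n (A B : 'M[int]_n) : (A^T = A -> B^T = B ->
  mxdivides A B <-> exists C, B = C *m A)%R.
Proof.
move=> At Bt; split=> [[C [BE|BE]]|[C BE]]; last by exists C; right.
  by exists C^T%R; rewrite -[in RHS]At -trmx_mul -BE.
by exists C.
Qed.

Theorem theorem3p6 (x : 'I_8 -> nat) (S : {fset nat})
  (x_pos : forall i : 'I_8, 0 < x i)
  (x_inj : injective x)
  (S_def : S = [fset x i | i : 'I_8]%fset)
  (S_gcd_closed : gcd_closed S)
  (card_G : #|` gtd_set S (x ord_max)| = 3)
  (card_D : #|` gtd_gcd_set S (x ord_max)| = 4) :
  mxdivides (gcd_matrix x) (lcm_matrix x) <-> condition_M S.
Proof.
have xS i : x i \in S by rewrite S_def; apply/imfsetP; exists i.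
have [s [sS s_inj sM]] := gtd_gcd_cube S_gcd_closed (xS ord_max) card_G card_D.
have /fin_all_exists[f fE] p : exists i, x i = s p.
  by have := sS p; rewrite S_def => /imfsetP[/= i _ ->]; exists i.
have f_inj : injective f by move=> p q e; apply: s_inj; rewrite -!fE e.
(* Both sides have eight elements, so the cube exhausts [S]. *)
have [g gK fK] : bijective f.
  by apply: (inj_card_bij f_inj); rewrite !card_prod !card_bool card_ord.
have S_E z : z \in S -> exists p, z = s p.
  by rewrite S_def => /imfsetP[/= i _ ->]; exists (g i); rewrite -fE fK.
have s_gt0 p : 0 < s p by rewrite -fE.
have f_bij : {on predT, bijective f} by apply: onW_bij; exists g.
rewrite (condition_M_cube_divides S_E sS s_gt0 s_inj sM).
rewrite mxdivides_symmetric; first last.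
- by apply/matrixP => i j; rewrite !mxE lcmnC.
- by apply/matrixP => i j; rewrite !mxE gcdnC.
split=> [[C CE] | [C CE]].
  exists (fun q r => C (f q) (f r)) => q p.
  have := congr1 (fun A : 'M_8 => A (f q) (f p)) CE; rewrite !mxE !fE => ->.
  rewrite (reindex f) //=; apply: eq_bigr => r _; by rewrite !mxE !fE.
exists (\matrix_(i, j) C (g i) (g j))%R; apply/matrixP => i j; rewrite !mxE.
rewrite -(fK i) -(fK j) !fE CE [RHS](reindex f) //=.
by apply: eq_bigr => r _; rewrite !mxE !fE !gK.
Qed.
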